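(* Let $F$ be a conic pseudo-Finsler metric on a surface and let $\overline F=e^{\phi}F$ be a proper anisotropic conformal transformation of $F$. Then: (i) The transformation is $C$-anisotropic conformal if and only if either $F$ is a Riemannian metric or $m^i\partial_i\phi=0$. (ii) The transformation is $\overline C$-anisotropic conformal if and only if either $\mathcal I=\frac{\varepsilon}{2}(\ln\rho-4\phi)_{;2}$ (that is, $\overline F$ is a Riemannian metric) or $m^i\partial_i\phi-\varepsilon\phi_{;2}\ell^i\partial_i\phi=0$. (iii) Assume that $F$ and $\overline F$ are both non-Riemannian. Then the property of being $C$-anisotropic conformal is invariant (i.e. the transformation, being $C$-anisotropic conformal, is also $\overline C$-anisotropic conformal) if and only if $\ell^i\partial_i\phi=0$.
   Context: $M$ is a smooth 2-dimensional manifold with local coordinates $(x^i)$ and induced coordinates $(x^i,y^i)$ on $TM$; $\partial_i=\partial/\partial x^i$, $\dot\partial_i=\partial/\partial y^i$. $\mathcal A\subset TM_0=TM\setminus(0)$ is a conic sub-bundle (non-empty, open, invariant under $y\mapsto\lambda y$, $\lambda>0$, projecting onto $M$). A function is $h(r)$ if it is positively homogeneous of degree $r$ in $y$. A conic pseudo-Finsler metric is a smooth $h(1)$ function $F:\mathcal A\to\mathbb R$ with $g_{ij}=\frac12\dot\partial_i\dot\partial_jF^2$ non-degenerate. Modified Berwald frame: $\ell_i=\dot\partial_iF$, $\ell^i=y^i/F$, $g_{ij}=\ell_i\ell_j+\varepsilon m_im_j$ with $\varepsilon=\pm1$, $m^i=g^{ij}m_j$, so $\ell^i\ell_i=1$,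 $\ell^im_i=\ell_im^i=0$, $m^im_i=\varepsilon$. The main scalar $\mathcal I$ is defined by $FC_{ijk}=\mathcal I m_im_jm_k$, where $C_{ijk}=\frac12\dot\partial_kg_{ij}$ is the Cartan tensor and $C^i_{jk}=g^{ir}C_{rjk}$; $F$ is Riemannian iff $\mathcal I=0$. For smooth $f$ on $\mathcal A$: $F\dot\partial_if=f_{;1}\ell_i+f_{;2}m_i$. An anisotropic conformal transformation of $F$ is $\overline F=e^{\phi(x,y)}F$ with $\phi$ a smooth $h(0)$ function on $\mathcal A$ such that $\varepsilon+\sigma-(\phi_{;2})^2\ne0$, where $\sigma=\phi_{;2;2}+\varepsilon\mathcal I\phi_{;2}+2(\phi_{;2})^2$; put $\rho=\frac{1}{\sigma+\varepsilon-(\phi_{;2})^2}$, and $(\ln\rho)_{;2}$ means $\rho_{;2}/\rho$. It is proper if $\phi_{;2}\neq0$. Bars denote objects associated with $\overline F$; the frame of $\overline F$ is taken with the same sign $\varepsilon$, $\overline m_i=e^{\phi}\sqrt{\varepsilon/\rho}\,m_i$. A proper anisotropic conformal change is $C$-anisotropic conformal if $C^i_{jk}\partial_i\phi=0$, and $\overline C$-anisotropic conformal if $\overline C^i_{jk}\partial_i\phi=0$.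
   Formalization: The ''either … or'' in (i) and (ii) is read at each point of an arbitrary subset of the domain, not as a global alternative, and ''non-Riemannian'' in (iii) means Riemannian at no point of that subset; read globally, (i) and (iii) fail for smooth data. *)

(* Defs.v *)
From HB Require Import structures.
From mathcomp Require Import all_boot all_order all_algebra.
From mathcomp Require Import all_classical all_reals all_analysis.
Set Implicit Arguments.
Unset Strict Implicit.
Unset Printing Implicit Defensive.
Import Order.TTheory GRing.Theory Num.Theory.
Import numFieldNormedType.Exports.
Local Open Scope classical_set_scope.
Local Open Scope ring_scope.

(* C^n on D, meaningful for D open.  Quantifying over all directions v is, for
   differentiable maps, the same as iterating partial derivatives. *)
Fixpoint Cn_on (R : realType) (V W : normedModType R) (n : nat) (D : set V)
    (f : V -> W) : Prop :=
  if n is n'.+1 then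
    (forall p, D p -> differentiable f p) /\
    (forall v : V, Cn_on n' D (fun p => 'D_v f p))
  else forall p, D p -> {for p, continuous f}.

Definition smooth_on (R : realType) (V W : normedModType R) (D : set V)
    (f : V -> W) : Prop := forall n, Cn_on n D f.

(* Smooth 2-manifold given by an atlas, not required to be maximal.  The maps
   coord a and param a matter only on dom a and img a, where they are mutually
   inverse. *)
Record surface (R : realType) := Surface {
  points :> topologicalType;
  chart : Type;
  dom : chart -> set points;
  img : chart -> set 'rV[R]_2;
  coord : chart -> points -> 'rV[R]_2;
  param : chart -> 'rV[R]_2 -> points;
  points_hausdorff : hausdorff_space points;
  points_second_countable : @second_countable points;
  dom_open : forall a, open (dom a);
  img_open : forall a, open (img a);
  dom_cover : forall x, exists a, dom a x;
  coordK : forall a x, dom a x -> img a (coord a x) /\ param a (coord a x) = x;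
  paramK : forall a u, img a u -> dom a (param a u) /\ coord a (param a u) = u;
  coord_continuous : forall a x, dom a x -> {for x, continuous (coord a)};
  param_continuous : forall a u, img a u -> {for u, continuous (param a)};
  transition_smooth : forall a b,
    smooth_on [set u | img a u /\ dom b (param a u)] (coord b \o param a)
}.

(* A pair (x, y) stands for the tangent vector y^i d/dx^i at the point with
   coordinates x. *)
Notation tpair R := ('rV[R]_2 * 'rV[R]_2)%type.

Section TangentBundle.
Variables (R : realType) (M : surface R).

Definition toverlap (a b : chart M) : set (tpair R) :=
  [set p | img a p.1 /\ dom b (param a p.1)].

Definition ttransition (a b : chart M) (p : tpair R) : tpair R :=
  let tau : 'rV[R]_2 -> 'rV[R]_2 := coord b \o param a in
  (tau p.1, 'd tau (p.1) (p.2)).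

(* TM is the gluing of the sets img a x R^2 along ttransition: subsets of TM and
   functions on them are the compatible families of local representatives. *)
Definition is_tset (A : chart M -> set (tpair R)) : Prop :=
  (forall a p, A a p -> img a p.1) /\
  (forall a b p, toverlap a b p -> (A a p <-> A b (ttransition a b p))).

Definition is_tfun (A : chart M -> set (tpair R))
    (f : chart M -> tpair R -> R) : Prop :=
  forall a b p, A a p -> toverlap a b p -> f b (ttransition a b p) = f a p.

Definition conic_subbundle (A : chart M -> set (tpair R)) : Prop :=
  [/\ is_tset A,
      exists a p, A a p,
      forall a, open (A a),
      forall a p, A a p -> p.2 != 0 &
      (forall a p (lam : R), A a p -> 0 < lam -> A a (p.1, lam *: p.2)) /\
      (forall a x, img a x -> exists y, A a (x, y))].

Definition homogeneous (r : nat) (A : chart M -> set (tpair R))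
    (f : chart M -> tpair R -> R) : Prop :=
  forall a p (lam : R), A a p -> 0 < lam ->
    f a (p.1, lam *: p.2) = lam ^+ r * f a p.

End TangentBundle.

Section LocalTensors.
Variable R : realType.
Implicit Types (F f phi I : tpair R -> R) (m : tpair R -> 'rV[R]_2) (p : tpair R).

Definition dx (i : 'I_2) f p : R :=
  'D_((delta_mx 0 i, 0) : tpair R) f p.

Definition dy (i : 'I_2) f p : R :=
  'D_((0, delta_mx 0 i) : tpair R) f p.

Definition metric F p : 'M[R]_2 :=
  \matrix_(i, j) (2^-1 * dy i (dy j (fun q => F q ^+ 2)) p).

Definition cartan F (i j k : 'I_2) p : R :=
  2^-1 * dy k (fun q => metric F q i j) p.

Definition cartan_up F (i j k : 'I_2) p : R :=
  \sum_(r < 2) invmx (metric F p) i r * cartan F r j k p.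

Definition riemannian_at F p : Prop := forall i j k, cartan F i j k p = 0.

Definition ell_dn F p : 'rV[R]_2 := \row_i dy i F p.

Definition ell_up F p : 'rV[R]_2 := (F p)^-1 *: p.2.

Definition m_up F m p : 'rV[R]_2 :=
  \row_i \sum_(j < 2) invmx (metric F p) i j * m p 0 j.

Definition frame_mx F m p : 'M[R]_2 :=
  \matrix_(a, i) (if a == ord0 then ell_dn F p 0 i else m p 0 i).

(* The row (f_{;1}, f_{;2}) obtained by solving
   F d f / d y^i = f_{;1} l_i + f_{;2} m_i, see vderE below. *)
Definition vder F m f p : 'rV[R]_2 :=
  (F p *: \row_i dy i f p) *m invmx (frame_mx F m p).

Definition vder1 F m f p : R := vder F m f p 0 0.
Definition vder2 F m f p : R := vder F m f p 0 1.

Definition sigma (eps : R) F m I phi p : R :=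
  vder2 F m (vder2 F m phi) p + eps * I p * vder2 F m phi p
  + 2 * vder2 F m phi p ^+ 2.

Definition rho (eps : R) F m I phi p : R :=
  (sigma eps F m I phi p + eps - vder2 F m phi p ^+ 2)^-1.

Definition ell_dx F phi p : R := \sum_(i < 2) ell_up F p 0 i * dx i phi p.
Definition m_dx F m phi p : R := \sum_(i < 2) m_up F m p 0 i * dx i phi p.

Lemma vderE (eps : R) F m f p :
  metric F p \in unitmx ->
  (forall i j, metric F p i j =
     ell_dn F p 0 i * ell_dn F p 0 j + eps * (m p 0 i * m p 0 j)) ->
  forall i, F p * dy i f p =
    vder1 F m f p * ell_dn F p 0 i + vder2 F m f p * m p 0 i.
Proof.
move=> gU gE i; pose B := frame_mx F m p.
have gB : metric F p =
    B^T *m (\matrix_(a, b) ((if a == ord0 then 1 else eps) * B a b)).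
  apply/matrixP => k j.
  rewrite gE [RHS]mxE big_ord_recl big_ord1 ![(_^T) _ _]mxE.
  by rewrite !mxE /= mul1r mulrCA.
have BU : B \in unitmx.
  move: gU; rewrite gB unitmxE det_mulmx unitrM det_tr => /andP[BU _].
  by rewrite unitmxE.
have /rowP/(_ i) : vder F m f p *m B = F p *: \row_i dy i f p.
  by rewrite /vder mulmxKV.
have B0 : B 0 i = ell_dn F p 0 i by rewrite mxE.
have B1 : B 1 i = m p 0 i by rewrite mxE.
rewrite mxE [RHS]mxE mxE big_ord_recl big_ord1 => <-.
by rewrite (_ : lift ord0 ord0 = 1) ?B0 ?B1 //; apply/val_inj.
Qed.

End LocalTensors.

Section AnisotropicConformal.
Variables (R : realType) (M : surface R).
Implicit Types (A D : chart M -> set (tpair R)).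
Implicit Types (F phi I : chart M -> tpair R -> R).
Implicit Types (m : chart M -> tpair R -> 'rV[R]_2).

Definition conic_pseudo_finsler A F : Prop :=
  [/\ is_tfun A F,
      forall a, smooth_on (A a) (F a),
      homogeneous 1 A F &
      forall a p, A a p -> metric (F a) p \in unitmx].

(* m is determined by the metric only up to sign, and its sign need not be
   coherent over M: each chart carries its own smooth choice m a. *)
Definition berwald_frame A F (eps : R) m : Prop :=
  [/\ eps = 1 \/ eps = -1,
      forall a, smooth_on (A a) (m a) &
      forall a p, A a p -> forall i j, metric (F a) p i j =
        ell_dn (F a) p 0 i * ell_dn (F a) p 0 j + eps * (m a p 0 i * m a p 0 j)].

Definition main_scalar A F m I : Prop :=
  forall a p, A a p -> forall i j k,
    F a p * cartan (F a) i j k p = I a p * m a p 0 i * m a p 0 j * m a p 0 k.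

Definition conformal_change phi F : chart M -> tpair R -> R :=
  fun a p => expR (phi a p) * F a p.

Definition anisotropic_conformal A F (eps : R) m I phi : Prop :=
  [/\ is_tfun A phi,
      forall a, smooth_on (A a) (phi a),
      homogeneous 0 A phi &
      forall a p, A a p ->
        eps + sigma eps (F a) (m a) (I a) (phi a) p
        - vder2 (F a) (m a) (phi a) p ^+ 2 != 0].

Definition proper_anisotropic_conformal A F (eps : R) m I phi : Prop :=
  anisotropic_conformal A F eps m I phi /\
  (forall a p, A a p -> vder2 (F a) (m a) (phi a) p != 0).

(* D = A gives the notions for the transformation itself. *)
Definition C_anisotropic_on D F phi : Prop :=
  forall a p, D a p -> forall j k : 'I_2,
    \sum_(i < 2) cartan_up (F a) i j k p * dx i (phi a) p = 0.

Definition Cbar_anisotropic_on D F phi : Prop :=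
  C_anisotropic_on D (conformal_change phi F) phi.

(* (eps / 2) (ln rho - 4 phi)_{;2} *)
Definition riemannian_main_scalar F (eps : R) m I phi (a : chart M) (p : tpair R)
    : R :=
  let r := rho eps (F a) (m a) (I a) (phi a) in
  eps / 2 * (vder2 (F a) (m a) r p / r p - 4 * vder2 (F a) (m a) (phi a) p).

End AnisotropicConformal.

(* Main.v *)
Require Import Defs.
From HB Require Import structures.
From mathcomp Require Import all_boot all_order all_algebra.
From mathcomp Require Import all_classical all_reals all_analysis.
From mathcomp Require Import ring.
Set Implicit Arguments.
Unset Strict Implicit.
Unset Printing Implicit Defensive.
Import Order.TTheory GRing.Theory Num.Theory.
Import numFieldNormedType.Exports.
Local Open Scope classical_set_scope.
Local Open Scope ring_scope.

(** The statement is fibrewise, so the proof takes place in one chart, on an open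
    conic set U of pairs (x, y), and differentiates in y only.

    Write u = phi_{;2}, w = 1 / rho and n_i = l_i + u m_i. Since g is
    non-degenerate, F does not vanish, and the frame (l_i, m_i) is independent.
    Homogeneity gives y^i l_i = F and y^i m_i = 0, and differentiating
    g_ij = l_i l_j + eps m_i m_j gives the Berwald equations
      F d_i l_j = eps m_i m_j,   F d_k m_i = m_k (eps I m_i - l_i).
    The functions phi and phi_{;2} have no component along l_i, by Euler's theorem,
    so that two differentiations of e^phi F lead to
      gbar_ij = e^(2 phi) (n_i n_j + w m_i m_j)       (metric_bar).
    A third differentiation gives
      2 F Cbar_ijk = e^(2 phi) (w_{;2} + 4 u w + 2 eps I w) m_i m_j m_k
                                                      (cartan_bar),
    where w has no component along l_i because gbar is homogeneous of degree 0.
    The scalar factor vanishes exactly when I = eps / 2 (ln rho - 4 phi)_{;2},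
    which is therefore the condition for the new metric to be Riemannian.

    Both Cartan tensors are multiples of m_i m_j m_k. Hence C^i_jk d_i phi = 0 means
    that either the multiple or the derivative of phi along the vector dual to m_i
    vanishes. For g this vector is m^i; for gbar it is annihilated by n_i, hence
    proportional to m^i - eps u l^i (raised_m_bar). This gives (i) and (ii). Under
    the assumptions of (iii), (i) gives m^i d_i phi = 0, and the condition of (ii)
    becomes u l^i d_i phi = 0, where u is nowhere zero. *)

(** * Smooth functions on an open set *)

Section SmoothFunctions.
Context {R : realType} {V : normedModType R}.
Implicit Types (U : set V) (f g : V -> R).

Lemma near_eq_differentiable f g p :
  {near p, f =1 g} -> differentiable f p -> differentiable g p.
Proof.
move=> fg df.
(* g - f vanishes near p, so it is differentiable with differential 0 *)
suff d0 : differentiable (g - f : V -> R) p.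
  have -> : g = (g - f) + f by apply/funext => q; rewrite !fctE subrK.
  exact: differentiableD.
have c0 : continuous (\0 : V -> R) by move=> x; exact: cst_continuous.
have fg0 : \forall h \near (0 : V), f (h + p) = g (h + p).
  have cv : (h + p) @[h --> (0 : V)] --> p.
    by rewrite -[X in _ --> X]add0r; apply: cvgD; [exact: cvg_id|exact: cvg_cst].
  exact: cv fg.
have H : (g - f) \o shift p = cst ((g - f) p) + (\0 : V -> R) +o_ 0 id.
  apply/eqaddoP => e e0; near=> h.
  have fgh : f (h + p) = g (h + p) by near: h.
  rewrite !fctE /= (nbhs_singleton fg) fgh !subrr !addr0 oppr0 addr0.
  by rewrite normr0 mulr_ge0 // ltW.
by apply/diff_locallyP; rewrite (diff_unique c0 H); split.
Unshelve. all: by end_near.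
Qed.

Lemma open_near_eq U f g p :
  open U -> (forall q, U q -> f q = g q) -> U p -> {near p, f =1 g}.
Proof. by move=> oU fg Up; apply: filterS fg _; exact: open_nbhs_nbhs. Qed.

Lemma open_eq_derive U f g v p :
  open U -> (forall q, U q -> f q = g q) -> U p -> 'D_v f p = 'D_v g p.
Proof. by move=> oU fg Up; apply: near_eq_derive; exact: open_near_eq fg Up. Qed.

Lemma Cn_on_ext n U f g :
  open U -> (forall p, U p -> f p = g p) -> Cn_on n U f -> Cn_on n U g.
Proof.
move=> oU; elim: n f g => [|n IH] f g fg /=.
  move=> cf p Up; have nfg := open_near_eq oU fg Up.
  rewrite /prop_for /continuous_at -(fg p Up).
  by apply: cvg_trans (cf p Up); apply: near_eq_cvg.
move=> [df Df]; split=> [p Up|v].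
  by apply: near_eq_differentiable (df p Up); exact: open_near_eq fg Up.
by apply: IH (Df v) => p Up; exact: open_eq_derive fg Up.
Qed.

Lemma Cn_onW n U f : Cn_on n.+1 U f -> Cn_on n U f.
Proof.
elim: n f => [|n IH] f [df Df] /=.
  by move=> p Up; exact/differentiable_continuous/df.
by split=> // v; exact/IH/Df.
Qed.

Lemma Cn_on_cst n U (c : R) : Cn_on n U (fun=> c).
Proof.
elim: n c => [|n IH] c /=; first by move=> p _; exact: cst_continuous.
split=> [p _|v]; first exact: differentiable_cst.
have -> : (fun p => 'D_v (fun=> c) p) = (fun=> 0 : R) :> (V -> R).
  by apply/funext => p; exact: derive_cst.
exact: IH.
Qed.

Lemma Cn_onD n U f g : open U ->
  Cn_on n U f -> Cn_on n U g -> Cn_on n U (fun p => f p + g p).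
Proof.
move=> oU; elim: n f g => [|n IH] f g /=.
  by move=> cf cg p Up; apply: cvgD; [exact: cf|exact: cg].
move=> [df Df] [dg Dg]; split=> [p Up|v].
  by apply: differentiableD; [exact: df|exact: dg].
apply: Cn_on_ext (IH _ _ (Df v) (Dg v)) => // p Up /=.
by rewrite -deriveD //; apply: diff_derivable; [exact: df|exact: dg].
Qed.

Lemma Cn_onM n U f g : open U ->
  Cn_on n U f -> Cn_on n U g -> Cn_on n U (fun p => f p * g p).
Proof.
move=> oU; elim: n f g => [|n IH] f g.
  by move=> cf cg p Up; apply: cvgM; [exact: cf|exact: cg].
move=> Cf Cg; have [df Df] := Cf; have [dg Dg] := Cg.
split=> [p Up|v].
  by apply: differentiableM; [exact: df|exact: dg].
have C := Cn_onD oU (IH _ _ (Cn_onW Cf) (Dg v)) (IH _ _ (Cn_onW Cg) (Df v)).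
apply: Cn_on_ext C => // p Up /=.
by rewrite -deriveM //; apply: diff_derivable; [exact: df|exact: dg].
Qed.

Lemma Cn_onV n U f : open U -> (forall p, U p -> f p != 0) ->
  Cn_on n U f -> Cn_on n U (fun p => (f p)^-1).
Proof.
move=> oU f0; elim: n => [|n IH].
  by move=> cf p Up; apply: cvgV; [exact: f0|exact: cf].
move=> Cf; have [df Df] := Cf.
split=> [p Up|v].
  by apply: differentiableV; [exact: df|exact: f0].
have CV := IH (Cn_onW Cf).
have C := Cn_onM oU (Cn_onM oU (Cn_on_cst n U (-1)) (Cn_onM oU CV CV)) (Df v).
apply: Cn_on_ext C => // p Up /=.
rewrite deriveV ?f0 //; last exact/diff_derivable/df.
by rewrite mulN1r -invfM -expr2.
Qed.

Lemma smooth_ext U f g :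
  open U -> (forall p, U p -> f p = g p) -> smooth_on U f -> smooth_on U g.
Proof. by move=> oU fg Cf n; exact: Cn_on_ext fg (Cf n). Qed.

Lemma smooth_cst U (c : R) : smooth_on U (fun=> c).
Proof. by move=> n; exact: Cn_on_cst. Qed.

Lemma smoothD U f g : open U ->
  smooth_on U f -> smooth_on U g -> smooth_on U (fun p => f p + g p).
Proof. by move=> oU Cf Cg n; exact: Cn_onD. Qed.

Lemma smoothM U f g : open U ->
  smooth_on U f -> smooth_on U g -> smooth_on U (fun p => f p * g p).
Proof. by move=> oU Cf Cg n; exact: Cn_onM. Qed.

Lemma smooth_sqr U f : open U ->
  smooth_on U f -> smooth_on U (fun p => f p ^+ 2).
Proof.
by move=> oU Cf; apply: smooth_ext (smoothM oU Cf Cf) => // p _; rewrite expr2.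
Qed.

Lemma smoothV U f : open U -> (forall p, U p -> f p != 0) ->
  smooth_on U f -> smooth_on U (fun p => (f p)^-1).
Proof. by move=> oU f0 Cf n; exact: Cn_onV. Qed.

Lemma smoothN U f : open U -> smooth_on U f -> smooth_on U (fun p => - f p).
Proof.
move=> oU Cf; apply: smooth_ext (smoothM oU (smooth_cst U (-1)) Cf) => // p _.
exact: mulN1r.
Qed.

Lemma smooth_derive U f v : smooth_on U f -> smooth_on U (fun p => 'D_v f p).
Proof. by move=> Cf n; exact: (Cf n.+1).2. Qed.

Lemma smooth_differentiable U f p : smooth_on U f -> U p -> differentiable f p.
Proof. by move=> Cf; exact: (Cf 1%N).1. Qed.

Lemma smooth_derivable U f v p : smooth_on U f -> U p -> derivable f p v.
Proof. by move=> Cf Up; exact/diff_derivable/(smooth_differentiable Cf). Qed.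

Lemma smooth_sum U n (f : 'I_n -> V -> R) : open U ->
  (forall i, smooth_on U (f i)) -> smooth_on U (fun p => \sum_(i < n) f i p).
Proof.
move=> oU; elim: n f => [|n IH] f Cf.
  by apply: smooth_ext (smooth_cst U 0) => // p _; rewrite big_ord0.
have CS := smoothD oU (Cf ord0) (IH _ (fun i => Cf (lift ord0 i))).
by apply: smooth_ext CS => // p _; rewrite big_ord_recl.
Qed.

Lemma smooth_coord U n (w : V -> 'rV[R]_n) i :
  open U -> smooth_on U w -> smooth_on U (fun p => w p 0 i).
Proof.
move=> oU Cw k; move: (Cw k) => {Cw}; elim: k w => [|k IH] w.
  move=> cw p Up; pose c (N : 'rV[R]_n) := N 0 i.
  apply: (@continuous_comp _ _ _ w c) (cw p Up) _.
  exact: coord_continuous.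
move=> [dw Dw]; split=> [p Up|v].
  pose c (N : 'rV[R]_n) := N 0 i.
  apply: (@differentiable_comp _ _ _ _ w c) (dw p Up) _.
  exact: differentiable_coord.
apply: Cn_on_ext (IH _ (Dw v)) => // p Up.
by rewrite derive_mx ?mxE //; exact/diff_derivable/dw.
Qed.

End SmoothFunctions.
Section ExpSmooth.
Context {R : realType} {V : normedModType R}.

Lemma differentiable_expR_comp (f : V -> R) p :
  differentiable f p -> differentiable (fun q => expR (f q)) p.
Proof.
move=> df; apply: (@differentiable_comp _ _ _ _ f expR) => //.
exact/derivable1_diffP/derivable_expR.
Qed.

Lemma derive_expR_comp (f : V -> R) p v :
  differentiable f p -> 'D_v (fun q => expR (f q)) p = expR (f p) * 'D_v f p.
Proof.
move=> df; have de : differentiable (@expR R) (f p).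
  exact/derivable1_diffP/derivable_expR.
rewrite deriveE; last exact: differentiable_expR_comp.
rewrite (@diff_comp _ _ _ _ f expR) //= (deriveE _ df).
rewrite deriv1E; last exact: derivable_expR.
by rewrite derive1E derive_val [LHS]mulrC.
Qed.

Lemma smooth_expR (U : set V) (f : V -> R) : open U ->
  smooth_on U f -> smooth_on U (fun q => expR (f q)).
Proof.
move=> oU Cf; elim=> [|n IH] /=.
  move=> p Up; apply: (@continuous_comp _ _ _ f expR) ((Cf 0%N) p Up) _.
  exact: continuous_expR.
split=> [p Up|v].
  exact/differentiable_expR_comp/(smooth_differentiable Cf).
apply: Cn_on_ext (Cn_onM oU IH ((Cf n.+1).2 v)) => // p Up.
by rewrite derive_expR_comp //; exact: smooth_differentiable Cf Up.
Qed.

End ExpSmooth.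

(** * Homogeneous functions on the fibres *)

(** Directional derivatives depend on the increments only. *)
Lemma eq_increment_derive {R : realType} {V W : normedModType R}
    (f : V -> R) (g : W -> R) a b v w :
  (forall h, f (h *: v + a) - f a = g (h *: w + b) - g b) ->
  'D_v f a = 'D_w g b.
Proof.
move=> fg; rewrite /derive; congr (lim _).
apply: (congr1 (fun k : R -> R => k @ 0^')).
by apply/funext => h /=; rewrite fg.
Qed.

(** The partial derivative along the fibre coordinate of index i: a copy of dy
    that conversion does not unfold, so that algebraic tactics take it as an
    atom. *)
Definition pdy {R : realType} := locked (@dy R).

Lemma pdyE {R : realType} : @pdy R = @dy R.
Proof. by rewrite /pdy -lock. Qed.

Section FibreHomogeneity.
Context {R : realType}.
Implicit Types (U : set (tpair R)) (f : tpair R -> R) (p : tpair R).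

Definition fiber_scale (lam : R) p : tpair R := (p.1, lam *: p.2).

(** A set invariant under the dilations of the fibres by positive factors. *)
Definition conic U := forall p lam, U p -> 0 < lam -> U (fiber_scale lam p).

(** Positive homogeneity of degree r in the fibre variable, on U. *)
Definition homogeneous_on r U f := forall p lam, U p -> 0 < lam ->
  f (fiber_scale lam p) = lam ^+ r * f p.

Lemma derive_fiber_scale f lam (w : 'rV[R]_2) p :
  'D_((0, w) : tpair R) (f \o fiber_scale lam) p =
  'D_((0, lam *: w) : tpair R) f (fiber_scale lam p).
Proof.
apply: eq_increment_derive => h; congr (f _ - _).
apply: injective_projections; rewrite /fiber_scale /= ?scaler0 //.
by rewrite scalerDr !scalerA mulrC.
Qed.

Lemma homogeneous_pdy r U f i : open U -> smooth_on U f -> conic U ->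
  homogeneous_on r.+1 U f -> homogeneous_on r U (pdy i f).
Proof.
rewrite pdyE => oU Cf coU hf p lam Up lam0.
have US := coU p lam Up lam0.
have e1 : 'D_((0, delta_mx 0 i) : tpair R) (f \o fiber_scale lam) p =
    lam * dy i f (fiber_scale lam p).
  rewrite derive_fiber_scale /dy !deriveE; try exact: smooth_differentiable Cf US.
  rewrite -[RHS]/(lam *: _) -linearZ; congr ('d f _ _).
  by apply: injective_projections; rewrite /= ?scaler0.
apply: (mulfI (lt0r_neq0 lam0)); rewrite -e1 mulrA -exprS.
rewrite (@open_eq_derive _ _ U _ (lam ^+ r.+1 \*o f)) //; last first.
  by move=> q Uq /=; rewrite hf.
by rewrite deriveMl //; exact: smooth_derivable Cf Up.
Qed.

(** Euler's theorem. *)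
Lemma euler r U f p : open U -> smooth_on U f ->
  homogeneous_on r U f -> U p -> \sum_(i < 2) p.2 0 i * pdy i f p = r%:R * f p.
Proof.
rewrite pdyE => oU Cf hf Up; have df := smooth_differentiable Cf Up.
have -> : \sum_(i < 2) p.2 0 i * dy i f p = 'D_((0, p.2) : tpair R) f p.
  rewrite [in RHS](row_sum_delta p.2) deriveE //.
  have -> : ((0, \sum_j p.2 0 j *: delta_mx 0 j) : tpair R) =
      \sum_(j < 2) p.2 0 j *: ((0, delta_mx 0 j) : tpair R).
    rewrite !big_ord_recl !big_ord0 !addr0.
    by apply: injective_projections; rewrite /= ?scaler0 ?addr0.
  rewrite linear_sum; apply: eq_bigr => j _.
  by rewrite linearZ /dy deriveE.
have -> : 'D_((0, p.2) : tpair R) f p =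
    'D_1 (fun t : R => f (fiber_scale t p)) (1 : R).
  apply: eq_increment_derive => h.
  rewrite [_%:A]mulr1 /fiber_scale scale1r -surjective_pairing.
  congr (f _ - _).
  apply: injective_projections; rewrite /= ?scaler0 ?add0r //.
  by rewrite scalerDl scale1r.
have n1 : \forall t \near (1 : R), f (fiber_scale t p) = t ^+ r * f p.
  have : \forall t \near (1 : R), 0 < t by apply: lt_nbhsr.
  by apply: filterS => t; exact: hf.
rewrite (near_eq_derive _ n1).
rewrite (@deriveMr _ _ (fun t : R => t ^+ r) (f p)); last exact: exprn_derivable.
by rewrite exp_derive expr1n mulrC [_%:A]mulr1 [_%:A]mulr1.
Qed.

End FibreHomogeneity.

Section FibreDerivative.
Context {R : realType}.
Implicit Types (f g : tpair R -> R) (p : tpair R) (i : 'I_2).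

Lemma pdyD f g i p : differentiable f p -> differentiable g p ->
  pdy i (fun q => f q + g q) p = pdy i f p + pdy i g p.
Proof. by rewrite pdyE => df dg; apply: deriveD; exact: diff_derivable. Qed.

Lemma pdyM f g i p : differentiable f p -> differentiable g p ->
  pdy i (fun q => f q * g q) p = f p * pdy i g p + g p * pdy i f p.
Proof. by rewrite pdyE => df dg; apply: deriveM; exact: diff_derivable. Qed.

Lemma pdyMl f (c : R) i p : differentiable f p ->
  pdy i (fun q => c * f q) p = c * pdy i f p.
Proof. by rewrite pdyE => df; apply: deriveMl; exact: diff_derivable. Qed.

Lemma pdyV f i p : f p != 0 -> differentiable f p ->
  pdy i (fun q => (f q)^-1) p = - (f p) ^- 2 * pdy i f p.
Proof. by rewrite pdyE => f0 df; apply: deriveV => //; exact: diff_derivable. Qed.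

Lemma pdy_expR f i p : differentiable f p ->
  pdy i (fun q => expR (f q)) p = expR (f p) * pdy i f p.
Proof. rewrite pdyE; exact: derive_expR_comp. Qed.

Lemma eq_pdy U f g i p : open U -> (forall q, U q -> f q = g q) -> U p ->
  pdy i f p = pdy i g p.
Proof. rewrite pdyE; exact: open_eq_derive. Qed.

Lemma smooth_pdy U f i : smooth_on U f -> smooth_on U (pdy i f).
Proof. rewrite pdyE; exact: smooth_derive. Qed.

End FibreDerivative.

(** * Linear algebra of the plane *)

(** Subtracts from the left-hand side of an equation a multiple of a known one. *)
Lemma lin_comb {R : pzRingType} (c : R) {l r a b : R} :
  l = r -> a - c * (l - r) = b -> a = b.
Proof. by move=> ->; rewrite subrr mulr0 subr0. Qed.
Arguments lin_comb {R} c {l r a b}.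

Section PlaneAlgebra.
Context {R : realType}.
Implicit Types (n m x d : 'I_2 -> R) (G : 'M[R]_2).

Lemma sum2E (f : 'I_2 -> R) : \sum_(i < 2) f i = f 0 + f 1.
Proof.
rewrite big_ord_recl big_ord1; congr (_ + f _).
by apply/val_inj.
Qed.

Lemma ord2P (i : 'I_2) : i = 0 \/ i = 1.
Proof. by case: i => [[|[|//]]] lti; [left|right]; apply/val_inj. Qed.

Lemma det2E G : \det G = G 0 0 * G 1 1 - G 0 1 * G 1 0.
Proof.
have l0 : lift 0 0 = 1 :> 'I_2 by apply/val_inj.
have l1 : lift 1 0 = 0 :> 'I_2 by apply/val_inj.
rewrite (expand_det_row _ 0) sum2E /cofactor !det_mx11 !mxE l0 l1 /=.
ring.
Qed.

(** The determinant of a metric given in a frame (n_i, m_i). *)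
Lemma wedge_det n m c w G :
  (forall i j, G i j = c * (n i * n j + w * (m i * m j))) ->
  \det G = c ^+ 2 * w * (n 0 * m 1 - n 1 * m 0) ^+ 2.
Proof. by move=> hG; rewrite det2E !hG; ring. Qed.

Lemma covector_eq0 n m a b : n 0 * m 1 - n 1 * m 0 != 0 ->
  (forall i, a * n i + b * m i = 0) -> a = 0 /\ b = 0.
Proof.
move=> nm0 h; have h0 := h 0; have h1 := h 1.
split; apply: (mulIf nm0); rewrite mul0r.
  transitivity ((a * n 0 + b * m 0) * m 1 - (a * n 1 + b * m 1) * m 0).
    by ring.
  by rewrite h0 h1; ring.
transitivity ((a * n 1 + b * m 1) * n 0 - (a * n 0 + b * m 0) * n 1).
  by ring.
by rewrite h0 h1; ring.
Qed.

Lemma vector_eq0 n m x : n 0 * m 1 - n 1 * m 0 != 0 ->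
  \sum_(i < 2) n i * x i = 0 -> \sum_(i < 2) m i * x i = 0 -> forall i, x i = 0.
Proof.
rewrite !sum2E => nm0 hn hm i.
apply: (mulIf nm0); rewrite mul0r; case: (ord2P i) => ->.
  transitivity ((n 0 * x 0 + n 1 * x 1) * m 1 - (m 0 * x 0 + m 1 * x 1) * n 1).
    by ring.
  by rewrite hn hm; ring.
transitivity ((m 0 * x 0 + m 1 * x 1) * n 0 - (n 0 * x 0 + n 1 * x 1) * m 0).
  by ring.
by rewrite hn hm; ring.
Qed.

(** The vector x obtained by raising the index of m is annihilated by n. *)
Lemma raised_covector n m c w G : G \in unitmx ->
  (forall i j, G i j = c * (n i * n j + w * (m i * m j))) ->
  let x i := \sum_(j < 2) invmx G i j * m j in
  \sum_(i < 2) n i * x i = 0 /\ c * w * \sum_(i < 2) m i * x i = 1.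
Proof.
move=> GU hG x.
have : n 0 * m 1 - n 1 * m 0 != 0.
  apply: contraTneq GU => nm0.
  by rewrite unitmxE (wedge_det hG) nm0 expr0n mulr0 unitr0.
have c0 : c != 0.
  apply: contraTneq GU => c0.
  by rewrite unitmxE (wedge_det hG) c0 expr0n !mul0r unitr0.
have Gx i : \sum_(j < 2) G i j * x j = m i.
  have : G *m (invmx G *m \col_j m j) = \col_j m j by rewrite mulKVmx.
  move=> /matrixP/(_ i 0); rewrite [RHS]mxE => <-; rewrite [RHS]mxE.
  apply: eq_bigr => j _; congr (_ * _); rewrite mxE.
  by apply: eq_bigr => k _; rewrite [in RHS]mxE.
move=> nm0.
have [i|/eqP] := @covector_eq0 n m (c * \sum_(i < 2) n i * x i)
  (c * w * (\sum_(i < 2) m i * x i) - 1) nm0.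
  have := Gx i; rewrite !sum2E !hG => /eqP.
  by rewrite -subr_eq0 => /eqP <-; ring.
rewrite mulf_eq0 (negPf c0) /= => /eqP -> /eqP.
by rewrite subr_eq0 => /eqP.
Qed.

(** If x and xb are dual to m for the frames (l, m) and (l + u m, m), up to the
    factors eps and c, and y is dual to l, then xb is a multiple of
    x - eps u y. *)
Lemma sheared_dual (eps u c : R) (l m x xb y : 'I_2 -> R) :
  eps ^+ 2 = 1 -> c != 0 -> l 0 * m 1 - l 1 * m 0 != 0 ->
  \sum_(i < 2) l i * x i = 0 -> eps * \sum_(i < 2) m i * x i = 1 ->
  \sum_(i < 2) (l i + u * m i) * xb i = 0 ->
  c * \sum_(i < 2) m i * xb i = 1 ->
  \sum_(i < 2) l i * y i = 1 -> \sum_(i < 2) m i * y i = 0 ->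
  forall i, xb i = eps / c * (x i - eps * u * y i).
Proof.
move=> eps2 c0 lm0 lx mx lxb mxb ly my i.
have mxeps : \sum_(i < 2) m i * x i = eps.
  by rewrite -[RHS]mulr1 -mx mulrA -expr2 eps2 mul1r.
apply/eqP; rewrite -subr_eq0; apply/eqP.
apply: (@vector_eq0 l m
  (fun k => xb k - eps / c * (x k - eps * u * y k)) lm0).
all: move: lx mxeps lxb mxb ly my; rewrite !sum2E => lx mxeps lxb mxb ly my.
all: apply: (mulfI c0).
- apply: (lin_comb c lxb); apply: (lin_comb (- u) mxb).
  apply: (lin_comb (- eps) lx); apply: (lin_comb (u * eps ^+ 2) ly).
  by apply: (lin_comb u eps2); field.
- apply: (lin_comb 1 mxb); apply: (lin_comb (- eps) mxeps).
  apply: (lin_comb (eps ^+ 2 * u) my).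
  by apply: (lin_comb (-1) eps2); field.
Qed.

End PlaneAlgebra.

(** * Tensors of the form m_i m_j m_k *)

Section CartanTensor.
Context {R : realType}.
Context (F : tpair R -> R) (p : tpair R) (m : 'I_2 -> R) (kappa : R).
Context (cartanE : forall i j k, cartan F i j k p = kappa * m i * m j * m k).
Context (m_neq0 : exists i, m i != 0).

Lemma riemannian_atE : riemannian_at F p <-> kappa = 0.
Proof.
have [i mi0] := m_neq0; split=> [h|k0 a b c]; last by rewrite cartanE k0 !mul0r.
have /eqP := h i i i; rewrite cartanE !mulf_eq0 (negPf mi0) !orbF.
by move/eqP.
Qed.

(** Contracting the raised Cartan tensor with a covector d: the contraction
    factors through the value of d on the vector dual to m. *)
Lemma cartan_up_contraction (d : 'I_2 -> R) :
  (forall j k, \sum_(i < 2) cartan_up F i j k p * d i = 0) <->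
  kappa = 0 \/
  \sum_(i < 2) (\sum_(j < 2) invmx (metric F p) i j * m j) * d i = 0.
Proof.
set s := \sum_(i < 2) _.
have E j k : \sum_(i < 2) cartan_up F i j k p * d i = kappa * s * m j * m k.
  by rewrite /s /cartan_up !sum2E !cartanE; ring.
have [i mi0] := m_neq0; split=> [h|h j k].
  have /eqP := h i i; rewrite E !mulf_eq0 (negPf mi0) !orbF.
  by case/orP=> /eqP; [left|right].
by rewrite E; case: h => ->; rewrite ?mulr0 ?mul0r.
Qed.

End CartanTensor.

(** * The Finsler tensors in terms of fibre derivatives *)

Section FinslerTensors.
Context {R : realType}.
Implicit Types (F : tpair R -> R) (p : tpair R) (i j k : 'I_2).

Lemma metricE F p i j :
  metric F p i j = 2^-1 * pdy i (pdy j (fun q => F q ^+ 2)) p.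
Proof. by rewrite pdyE; exact: mxE. Qed.

Lemma cartanE F i j k p :
  cartan F i j k p = 2^-1 * pdy k (fun q => metric F q i j) p.
Proof. by rewrite pdyE. Qed.

Lemma ell_dnE F p i : ell_dn F p 0 i = pdy i F p.
Proof. by rewrite pdyE; exact: mxE. Qed.

End FinslerTensors.

(** * The metric of a homogeneous function *)

Section HomogeneousMetric.
Context {R : realType} (U : set (tpair R)) (F : tpair R -> R).
Context (oU : open U) (coU : conic U).
Context (CF : smooth_on U F) (hF : homogeneous_on 1 U F).

Lemma smooth_metric i j : smooth_on U (fun q => metric F q i j).
Proof.
have C := smoothM oU (smooth_cst U 2^-1)
  (smooth_pdy i (smooth_pdy j (smooth_sqr oU CF))).
by apply: smooth_ext C => // p _; rewrite metricE.
Qed.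

Lemma smooth_cartan i j k : smooth_on U (cartan F i j k).
Proof.
have C := smoothM oU (smooth_cst U 2^-1) (smooth_pdy k (smooth_metric i j)).
by apply: smooth_ext C => // p _; rewrite cartanE.
Qed.

Lemma homogeneous_metric i j : homogeneous_on 0 U (fun q => metric F q i j).
Proof.
have h2 : homogeneous_on 2 U (fun q => F q ^+ 2).
  by move=> p lam Up lam0; rewrite hF // exprMn expr1.
have h0 := homogeneous_pdy i oU (smooth_pdy j (smooth_sqr oU CF)) coU
  (homogeneous_pdy j oU (smooth_sqr oU CF) coU h2).
move=> p lam Up lam0.
have := h0 p lam Up lam0; rewrite expr0 !mul1r => e.
by apply: etrans (metricE _ _ _ _) _; rewrite e -metricE.
Qed.

Lemma metric_expand p i j : U p ->
  metric F p i j = pdy i F p * pdy j F p + F p * pdy i (pdy j F) p.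
Proof.
move=> Up; rewrite metricE.
have E q : U q -> pdy j (fun q => F q ^+ 2) q = 2 * (F q * pdy j F q).
  move=> Uq; rewrite (@eq_pdy _ U _ (fun q => F q * F q)) //.
  by rewrite pdyM; [ring|exact: smooth_differentiable CF Uq..].
rewrite (eq_pdy _ oU E) // pdyMl ?pdyM; last 3 first.
- exact: smooth_differentiable CF Up.
- exact: smooth_differentiable (smooth_pdy j CF) Up.
- exact: smooth_differentiable (smoothM oU CF (smooth_pdy j CF)) Up.
by field.
Qed.

(** Where F vanishes the metric has rank at most one. *)
Lemma metric_unit_neq0 p : U p -> metric F p \in unitmx -> F p != 0.
Proof.
move=> Up; apply: contraTneq => F0; rewrite unitmxE.
suff -> : \det (metric F p) = 0 by rewrite unitr0.
by rewrite det2E !(metric_expand _ _ Up) F0; ring.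
Qed.

End HomogeneousMetric.

(** * The Berwald frame *)

(** The i-th component of a field of covectors. *)
Definition component {R : realType} (m : tpair R -> 'rV[R]_2)
    (i : 'I_2) (p : tpair R) : R := m p 0 i.

(** The determinant of the frame (l_i, m_i). *)
Definition frame_wedge {R : realType} F (m : tpair R -> 'rV[R]_2) p : R :=
  pdy 0 F p * component m 1 p - pdy 1 F p * component m 0 p.

Section BerwaldFrame.
Context {R : realType} (U : set (tpair R)) (F : tpair R -> R).
Context (oU : open U) (coU : conic U).
Context (CF : smooth_on U F) (hF : homogeneous_on 1 U F).
Context (gU : forall p, U p -> metric F p \in unitmx).
Context (eps : R) (epsE : eps ^+ 2 = 1) (m : tpair R -> 'rV[R]_2).
Context (Cm : smooth_on U m).
Context (gE : forall p, U p -> forall i j, metric F p i j =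
  ell_dn F p 0 i * ell_dn F p 0 j + eps * (m p 0 i * m p 0 j)).
Context (I : tpair R -> R).
Context (hI : forall p, U p -> forall i j k,
  F p * cartan F i j k p = I p * m p 0 i * m p 0 j * m p 0 k).

Local Notation ell i := (pdy i F).
Local Notation mm i := (component m i).
Local Notation wedge := (frame_wedge F m).

Lemma eps_neq0 : eps != 0.
Proof. by have := oner_neq0 R; rewrite -epsE expf_eq0. Qed.

Lemma frame_metric p i j : U p ->
  metric F p i j = 1 * (ell i p * ell j p + eps * (mm i p * mm j p)).
Proof. by move=> Up; rewrite (gE Up) !ell_dnE mul1r. Qed.

Lemma wedge_neq0 p : U p -> wedge p != 0.
Proof.
move=> Up; apply: contraTneq (gU Up) => w0.
rewrite unitmxE (wedge_det (fun i j => frame_metric i j Up)).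
by rewrite -[_ - _]/(wedge p) w0 expr0n mulr0 unitr0.
Qed.

Lemma F_neq0 p : U p -> F p != 0.
Proof. by move=> Up; exact: metric_unit_neq0 oU CF _ Up (gU Up). Qed.

Lemma smooth_ell i : smooth_on U (ell i).
Proof. exact: smooth_pdy. Qed.

Lemma smooth_m i : smooth_on U (mm i).
Proof. exact: smooth_coord. Qed.

Lemma m_neq0 p : U p -> exists i, mm i p != 0.
Proof.
move=> Up; have [m0|] := eqVneq (mm 0 p) 0; last by exists 0.
exists 1; apply: contraNneq (wedge_neq0 Up) => m1.
by rewrite /frame_wedge m0 m1 !mulr0 subr0.
Qed.

(** The first Berwald equation. *)
Lemma pdy_ell p i j : U p -> F p * pdy i (ell j) p = eps * (mm i p * mm j p).
Proof.
move=> Up; have := gE Up i j; rewrite (metric_expand oU CF _ _ Up) !ell_dnE.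
by move/addrI.
Qed.

Lemma euler_ell p : U p -> \sum_(k < 2) p.2 0 k * ell k p = F p.
Proof. by move=> Up; rewrite (euler oU CF hF Up) mul1r. Qed.

Lemma euler_m p : U p -> \sum_(k < 2) p.2 0 k * mm k p = 0.
Proof.
move=> Up; have [i mi0] := m_neq0 Up.
have := euler oU (smooth_ell i) (homogeneous_pdy i oU CF coU hF) Up.
rewrite mul0r => /(congr1 (fun x => F p * x)); rewrite mulr0 => e.
apply: (mulIf mi0); apply: (mulfI eps_neq0); rewrite mul0r mulr0 -[RHS]e !sum2E.
apply: (lin_comb (- p.2 0 0) (pdy_ell 0 i Up)).
by apply: (lin_comb (- p.2 0 1) (pdy_ell 1 i Up)); ring.
Qed.

(** The second Berwald equation; the frame formula for the metric and the main
    scalar determine the derivative of m_i without reference to the sign of m. *)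
Lemma pdy_m p k i : U p ->
  F p * pdy k (mm i) p = mm k p * (eps * I p * mm i p - ell i p).
Proof.
move=> Up.
have dm a : differentiable (mm a) p by exact: smooth_differentiable (smooth_m a) Up.
have dl a : differentiable (ell a) p.
  by exact: smooth_differentiable (smooth_ell a) Up.
(* the symmetric product of X and m vanishes, and m is nonzero: X = 0 *)
pose X a := F p * pdy k (mm a) p - mm k p * (eps * I p * mm a p - ell a p).
have E a b : X a * mm b p + mm a p * X b = 0.
  have := hI Up a b k; rewrite cartanE.
  rewrite (@eq_pdy _ U _ (fun q => ell a q * ell b q + eps * (mm a q * mm b q)))
    //; last first.
    by move=> q Uq; rewrite frame_metric // mul1r.
  have dmm : differentiable (fun q => mm a q * mm b q) p.
    exact: differentiableM.
  rewrite pdyD; last 2 first.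
  - exact: differentiableM.
  - by apply: differentiableM => //; exact: differentiable_cst.
  rewrite pdyMl // !pdyM // => e.
  apply: (lin_comb (2 * eps) e).
  apply: (lin_comb (- (eps * ell b p)) (pdy_ell k a Up)).
  apply: (lin_comb (- (eps * ell a p)) (pdy_ell k b Up)).
  apply: (lin_comb (- (F p * (mm a p * pdy k (mm b) p + mm b p * pdy k (mm a) p)
    + mm k p * (ell a p * mm b p + ell b p * mm a p))) epsE).
  by rewrite /X -/(mm a p) -/(mm b p) -/(mm k p); field.
suff /eqP : X i = 0 by rewrite /X subr_eq0 => /eqP.
have [j mj0] := m_neq0 Up.
have Xj : X j = 0.
  have /eqP := E j j; rewrite [mm j p * _]mulrC -mulr2n -mulr_natr !mulf_eq0.
  by rewrite (negPf mj0) pnatr_eq0 !orbF => /eqP.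
by have /eqP := E i j; rewrite Xj mulr0 addr0 mulf_eq0 (negPf mj0) orbF => /eqP.
Qed.

(** The main scalar is not assumed smooth: contracting the Cartan tensor with m
    exhibits I (m_0^2 + m_1^2)^3 as a smooth function. *)
Lemma smooth_main_scalar : smooth_on U I.
Proof.
pose N p := mm 0 p ^+ 2 + mm 1 p ^+ 2.
pose T p := \sum_(i < 2) \sum_(j < 2) \sum_(k < 2)
  cartan F i j k p * (mm i p * (mm j p * mm k p)).
have N0 p : U p -> N p != 0.
  move=> Up; have [i mi0] := m_neq0 Up.
  rewrite paddr_eq0 ?sqr_ge0 // !expf_eq0 /=.
  by apply: contraNN mi0 => /andP[m0 m1]; case: (ord2P i) => ->.
have CN : smooth_on U (fun p => N p * (N p * N p)).
  have C : smooth_on U N.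
    by apply: smoothD => //; apply: smooth_sqr => //; exact: smooth_m.
  by apply: smoothM => //; exact: smoothM.
have CT : smooth_on U T.
  do 3! (apply: smooth_sum => // ?); apply: smoothM => //.
    exact: smooth_cartan.
  by apply: smoothM (smooth_m _) _ => //; apply: smoothM => //; exact: smooth_m.
have C := smoothM oU (smoothM oU CF CT) (smoothV oU _ CN).
apply: smooth_ext (C _) => // p Up; last by rewrite !mulf_neq0 ?N0.
apply: (mulIf (_ : N p * (N p * N p) != 0)); first by rewrite !mulf_neq0 ?N0.
rewrite mulfVK; last by rewrite !mulf_neq0 ?N0.
have -> : F p * T p = \sum_(i < 2) \sum_(j < 2) \sum_(k < 2)
    I p * mm i p * mm j p * mm k p * (mm i p * (mm j p * mm k p)).
  rewrite mulr_sumr; apply: eq_bigr => i _; rewrite mulr_sumr.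
  apply: eq_bigr => j _; rewrite mulr_sumr; apply: eq_bigr => k _.
  by rewrite mulrA (hI Up i j k).
by rewrite !sum2E /N; ring.
Qed.

Lemma vder_decomp f p i : U p ->
  F p * pdy i f p = vder1 F m f p * ell i p + vder2 F m f p * mm i p.
Proof.
by move=> Up; rewrite -(ell_dnE F p) pdyE; exact: vderE (gU Up) (gE Up) i.
Qed.

Lemma vder2E f p : U p ->
  vder2 F m f p = F p * (ell 0 p * pdy 1 f p - ell 1 p * pdy 0 f p) / wedge p.
Proof.
move=> Up; apply: (mulIf (wedge_neq0 Up)); rewrite divfK ?wedge_neq0 //.
apply: (lin_comb (ell 1 p) (vder_decomp f 0 Up)).
by apply: (lin_comb (- ell 0 p) (vder_decomp f 1 Up)); rewrite /frame_wedge; ring.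
Qed.

Lemma smooth_vder2 f : smooth_on U f -> smooth_on U (vder2 F m f).
Proof.
move=> Cf.
have Cw : smooth_on U wedge.
  apply: smoothD => //; first exact: smoothM (smooth_ell _) (smooth_m _).
  by apply: smoothN => //; exact: smoothM (smooth_ell _) (smooth_m _).
have Cn : smooth_on U (fun p => ell 0 p * pdy 1 f p - ell 1 p * pdy 0 f p).
  apply: smoothD => //; first exact: smoothM (smooth_ell _) (smooth_pdy _ _).
  by apply: smoothN => //; exact: smoothM (smooth_ell _) (smooth_pdy _ _).
have C := smoothM oU (smoothM oU CF Cn) (smoothV oU wedge_neq0 Cw).
by apply: smooth_ext C => // p Up; rewrite vder2E.
Qed.

(** A function constant along the rays has no component along l_i. *)
Lemma fiber_gradient f p i : U p -> \sum_(k < 2) p.2 0 k * pdy k f p = 0 ->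
  F p * pdy i f p = vder2 F m f p * mm i p.
Proof.
move=> Up yf.
have v1 : vder1 F m f p = 0.
  apply: (mulIf (F_neq0 Up)); rewrite mul0r.
  have h0 := vder_decomp f 0 Up; have h1 := vder_decomp f 1 Up.
  have := euler_ell Up; have := euler_m Up; move: yf; rewrite !sum2E => y0 ym yl.
  rewrite -[RHS](mulr0 (F p)) -y0 -{1}yl.
  transitivity (p.2 0 0 * (F p * pdy 0 f p) + p.2 0 1 * (F p * pdy 1 f p)
    - vder2 F m f p * (p.2 0 0 * mm 0 p + p.2 0 1 * mm 1 p)).
    by rewrite h0 h1; ring.
  by rewrite ym; ring.
by rewrite vder_decomp // v1 mul0r add0r.
Qed.

Lemma cartan_frame p i j k : U p ->
  cartan F i j k p = I p / F p * mm i p * mm j p * mm k p.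
Proof.
move=> Up; apply: (mulfI (F_neq0 Up)); rewrite (hI Up i j k).
by rewrite -/(mm i p) -/(mm j p) -/(mm k p); field; rewrite F_neq0.
Qed.

(** The Cartan tensor of F annihilates the gradient of phi at a point exactly when
    it vanishes there or phi has derivative 0 along m^i. *)
Lemma C_contraction phi p : U p ->
  (forall j k, \sum_(i < 2) cartan_up F i j k p * dx i phi p = 0) <->
  riemannian_at F p \/ m_dx F m phi p = 0.
Proof.
move=> Up; have c i j k := cartan_frame i j k Up.
rewrite (riemannian_atE c (m_neq0 Up)).
rewrite (cartan_up_contraction c (m_neq0 Up) (fun i => dx i phi p)).
suff -> : m_dx F m phi p =
  \sum_(i < 2) (\sum_(j < 2) invmx (metric F p) i j * mm j p) * dx i phi p by [].
by apply: eq_bigr => i _; rewrite mxE.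
Qed.

(** * The conformally changed metric *)

(** Here u, u2 and w stand for phi_{;2}, phi_{;2;2} and 1 / rho; only the equations
    that characterise them are used. *)
Section ConformalChange.
Context (phi u u2 w : tpair R -> R).
Context (Cphi : smooth_on U phi) (hphi : homogeneous_on 0 U phi).
Context (Cu : smooth_on U u) (Cw : smooth_on U w).
Context (pdy_phi : forall p i, U p -> F p * pdy i phi p = u p * mm i p).
Context (pdy_u : forall p i, U p -> F p * pdy i u p = u2 p * mm i p).
Context (wE : forall p, U p ->
  w p = u2 p + eps * I p * u p + u p ^+ 2 + eps).
Context (w_neq0 : forall p, U p -> w p != 0).

Local Notation E p := (expR (phi p)).
Local Notation Fbar := (fun q => E q * F q).
Local Notation n i p := (ell i p + u p * mm i p).

Lemma E_neq0 p : E p != 0.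
Proof. by rewrite gt_eqF // expR_gt0. Qed.

Lemma smooth_Fbar : smooth_on U Fbar.
Proof. by apply: smoothM CF => //; exact: smooth_expR. Qed.

Lemma homogeneous_Fbar : homogeneous_on 1 U Fbar.
Proof.
move=> p lam Up lam0; rewrite (hphi Up lam0) (hF Up lam0) expr0 mul1r.
by rewrite mulrCA.
Qed.

Lemma smooth_n i : smooth_on U (fun p => n i p).
Proof.
by apply: smoothD (smooth_ell i) _ => //; exact: smoothM (smooth_m i).
Qed.

Lemma pdy_exp p k : U p -> F p * pdy k (fun q => E q) p = E p * u p * mm k p.
Proof.
move=> Up; rewrite pdy_expR; last exact: smooth_differentiable Cphi Up.
by rewrite mulrCA pdy_phi // mulrA.
Qed.

Lemma pdy_Fbar p i : U p -> pdy i Fbar p = E p * n i p.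
Proof.
move=> Up; have de : differentiable (fun q => E q) p.
  exact: smooth_differentiable (smooth_expR oU Cphi) Up.
rewrite pdyM //; last exact: smooth_differentiable CF Up.
by apply: (lin_comb 1 (pdy_exp i Up)); ring.
Qed.

Lemma pdy_n p k i : U p -> F p * pdy k (fun q => n i q) p =
  mm k p * ((eps + u2 p + eps * I p * u p) * mm i p - u p * ell i p).
Proof.
move=> Up.
have dm : differentiable (mm i) p by exact: smooth_differentiable (smooth_m i) Up.
have dl : differentiable (ell i) p.
  exact: smooth_differentiable (smooth_ell i) Up.
have du : differentiable u p by exact: smooth_differentiable Cu Up.
have dum : differentiable (fun q => u q * mm i q) p by exact: differentiableM.
rewrite pdyD // pdyM //.
apply: (lin_comb 1 (pdy_ell k i Up)); apply: (lin_comb (u p) (pdy_m k i Up)).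
by apply: (lin_comb (mm i p) (pdy_u k Up)); ring.
Qed.

Lemma metric_bar p i j : U p ->
  metric Fbar p i j = E p ^+ 2 * (n i p * n j p + w p * (mm i p * mm j p)).
Proof.
move=> Up; rewrite (metric_expand oU smooth_Fbar _ _ Up) !pdy_Fbar //.
rewrite (eq_pdy i oU (fun q Uq => pdy_Fbar j Uq) Up).
have de : differentiable (fun q => E q) p.
  exact: smooth_differentiable (smooth_expR oU Cphi) Up.
rewrite pdyM //; last exact: smooth_differentiable (smooth_n j) Up.
apply: (lin_comb (E p ^+ 2) (pdy_n i j Up)).
apply: (lin_comb (E p * n j p) (pdy_exp i Up)).
by rewrite wE //; ring.
Qed.

(** No l_i survives: the components of the derivative along l_i l_j and l_i m_j
    cancel by the definition of w. *)
Lemma pdy_metric_bar p i j k : U p ->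
  F p * pdy k (fun q => metric Fbar q i j) p =
  E p ^+ 2 * (F p * pdy k w p + (4 * u p + 2 * (eps * I p)) * w p * mm k p)
  * (mm i p * mm j p).
Proof.
move=> Up.
have e q : U q -> metric Fbar q i j =
    E q * (E q * (n i q * n j q + w q * (mm i q * mm j q))).
  by move=> Uq; rewrite metric_bar // expr2 -mulrA.
have de : differentiable (fun q => E q) p.
  exact: smooth_differentiable (smooth_expR oU Cphi) Up.
have dn a : differentiable (fun q => n a q) p.
  exact: smooth_differentiable (smooth_n a) Up.
have dm a : differentiable (mm a) p.
  exact: smooth_differentiable (smooth_m a) Up.
have dw : differentiable w p by exact: smooth_differentiable Cw Up.
have dnn : differentiable (fun q => n i q * n j q) p by exact: differentiableM.
have dmm : differentiable (fun q => mm i q * mm j q) p by exact: differentiableM.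
have dwm : differentiable (fun q => w q * (mm i q * mm j q)) p.
  exact: differentiableM.
have ds : differentiable
    (fun q => n i q * n j q + w q * (mm i q * mm j q)) p.
  exact: differentiableD.
have des : differentiable
    (fun q => E q * (n i q * n j q + w q * (mm i q * mm j q))) p.
  exact: differentiableM.
rewrite (eq_pdy k oU e Up) pdyM // pdyM // pdyD //.
rewrite (pdyM _ (dn i) (dn j)) (pdyM _ dw dmm) (pdyM _ (dm i) (dm j)).
apply: (lin_comb (2 * E p * (n i p * n j p + w p * (mm i p * mm j p)))
  (pdy_exp k Up)).
apply: (lin_comb (E p ^+ 2 * n j p) (pdy_n k i Up)).
apply: (lin_comb (E p ^+ 2 * n i p) (pdy_n k j Up)).
apply: (lin_comb (E p ^+ 2 * w p * mm j p) (pdy_m k i Up)).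
apply: (lin_comb (E p ^+ 2 * w p * mm i p) (pdy_m k j Up)).
by rewrite wE //; ring.
Qed.

(** The new metric is homogeneous of degree 0, which forces w to be constant along
    the rays. *)
Lemma pdy_w p k : U p -> F p * pdy k w p = vder2 F m w p * mm k p.
Proof.
move=> Up; apply: fiber_gradient => //.
have [i mi0] := m_neq0 Up.
have c0 : E p ^+ 2 * (mm i p * mm i p) != 0.
  by rewrite mulf_neq0 ?expf_neq0 ?E_neq0 // mulf_neq0.
have := euler oU (smooth_metric oU smooth_Fbar i i)
  (homogeneous_metric oU coU smooth_Fbar homogeneous_Fbar i i) Up.
rewrite mul0r sum2E => e; apply: (mulIf c0); apply: (mulfI (F_neq0 Up)).
rewrite mul0r mulr0.
have ym := euler_m Up; rewrite sum2E in ym.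
rewrite sum2E; apply: (lin_comb (F p) e).
apply: (lin_comb (- p.2 0 0) (pdy_metric_bar i i 0 Up)).
apply: (lin_comb (- p.2 0 1) (pdy_metric_bar i i 1 Up)).
apply: (lin_comb (- (E p ^+ 2 * (4 * u p + 2 * (eps * I p)) * w p
   * (mm i p * mm i p))) ym).
ring.
Qed.

Lemma cartan_bar p i j k : U p -> cartan Fbar i j k p =
  E p ^+ 2 * (vder2 F m w p + 4 * u p * w p + 2 * (eps * I p) * w p)
  / (2 * F p) * mm i p * mm j p * mm k p.
Proof.
move=> Up; rewrite cartanE; apply: (mulfI (F_neq0 Up)).
apply: (lin_comb 2^-1 (pdy_metric_bar i j k Up)).
apply: (lin_comb (2^-1 * E p ^+ 2 * (mm i p * mm j p)) (pdy_w k Up)).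
by field; rewrite F_neq0.
Qed.

Lemma metric_bar_unit p : U p -> metric Fbar p \in unitmx.
Proof.
move=> Up; rewrite unitmxE (wedge_det (fun i j => metric_bar i j Up)).
have -> : n 0 p * mm 1 p - n 1 p * mm 0 p = wedge p.
  by rewrite /frame_wedge; ring.
by rewrite unitfE !mulf_neq0 ?expf_neq0 ?E_neq0 ?w_neq0 ?wedge_neq0.
Qed.

(** Raising the index of m with the two metrics gives vectors which, up to a
    scalar, differ by a multiple of the supporting direction. *)
Lemma raised_m_bar p i : U p ->
  \sum_(j < 2) invmx (metric Fbar p) i j * mm j p =
  eps / (E p ^+ 2 * w p) * (m_up F m p 0 i - eps * u p * ell_up F p 0 i).
Proof.
move=> Up.
have [le1 me1] := raised_covector (gU Up) (fun i j => frame_metric i j Up).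
have [le2 me2] := raised_covector (metric_bar_unit Up)
  (fun i j => metric_bar i j Up).
have cw0 : E p ^+ 2 * w p != 0 by rewrite !mulf_neq0 ?expf_neq0 ?E_neq0 ?w_neq0.
rewrite mul1r in me1; rewrite [m_up F m p 0 i]mxE.
have yE k : ell_up F p 0 k = (F p)^-1 * p.2 0 k by exact: mxE.
have [Fp0 wp0] := (F_neq0 Up, wedge_neq0 Up).
apply: (sheared_dual epsE cw0 wp0 le1 me1 le2 me2).
- have := euler_ell Up; rewrite !sum2E !yE => ly.
  by apply: (lin_comb (F p)^-1 ly); field.
- have := euler_m Up; rewrite !sum2E !yE => my.
  by rewrite -/(mm 0 p) -/(mm 1 p); apply: (lin_comb (F p)^-1 my); field.
Qed.

Lemma riemannian_bar p : U p -> riemannian_at Fbar p <->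
  vder2 F m w p + 4 * u p * w p + 2 * (eps * I p) * w p = 0.
Proof.
move=> Up.
rewrite (riemannian_atE (fun i j k => cartan_bar i j k Up) (m_neq0 Up)).
have c0 : E p ^+ 2 / (2 * F p) != 0.
  rewrite mulf_neq0 ?expf_neq0 ?E_neq0 // invr_eq0.
  by rewrite mulf_neq0 ?F_neq0 ?pnatr_eq0.
split=> [h|->]; last by rewrite mulr0 mul0r.
by apply: (mulfI c0); rewrite mulr0 -[RHS]h mulrAC.
Qed.

(** For the changed metric, the direction m^i is replaced by m^i - eps u l^i. *)
Lemma Cbar_contraction p : U p ->
  (forall j k, \sum_(i < 2) cartan_up Fbar i j k p * dx i phi p = 0) <->
  riemannian_at Fbar p \/ m_dx F m phi p - eps * u p * ell_dx F phi p = 0.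
Proof.
move=> Up; have c i j k := cartan_bar i j k Up.
rewrite (riemannian_atE c (m_neq0 Up)).
rewrite (cartan_up_contraction c (m_neq0 Up) (fun i => dx i phi p)).
have -> : \sum_(i < 2)
    (\sum_(j < 2) invmx (metric Fbar p) i j * mm j p) * dx i phi p =
    eps / (E p ^+ 2 * w p) * (m_dx F m phi p - eps * u p * ell_dx F phi p).
  rewrite /m_dx /ell_dx [X in X = _]sum2E (raised_m_bar 0 Up) (raised_m_bar 1 Up).
  rewrite !sum2E.
  move: (m_up F m p 0 0) (m_up F m p 0 1) (ell_up F p 0 0) (ell_up F p 0 1).
  by move: (dx 0 phi p) (dx 1 phi p) => d0 d1 m0 m1 l0 l1; ring.
have t0 : eps / (E p ^+ 2 * w p) != 0.
  by rewrite mulf_neq0 ?eps_neq0 ?invr_eq0 ?mulf_neq0 ?expf_neq0 ?E_neq0 ?w_neq0.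
split=> -[->|h]; [by left|right|by left|right]; last by rewrite h mulr0.
by apply: (mulfI t0); rewrite h mulr0.
Qed.

End ConformalChange.

(** * The semicolon derivatives of the conformal factor *)

Section AnisotropicChange.
Context (phi : tpair R -> R).
Context (Cphi : smooth_on U phi) (hphi : homogeneous_on 0 U phi).
Context (regular : forall p, U p ->
  eps + sigma eps F m I phi p - vder2 F m phi p ^+ 2 != 0).

Local Notation u := (vder2 F m phi).
Local Notation w :=
  (fun p => sigma eps F m I phi p + eps - vder2 F m phi p ^+ 2).

Lemma smooth_vder2_phi : smooth_on U u.
Proof. exact: smooth_vder2. Qed.

Lemma gradient_phi p i : U p -> F p * pdy i phi p = u p * mm i p.
Proof.
move=> Up; apply: fiber_gradient => //.
by rewrite (euler oU Cphi hphi Up) mul0r.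
Qed.

Lemma homogeneous_gradient i :
  homogeneous_on 0 U (fun q => F q * pdy i phi q).
Proof.
have CFp := smoothM oU CF Cphi.
have h1 : homogeneous_on 1 U (fun q => F q * phi q).
  move=> p lam Up lam0; rewrite (hF Up lam0) (hphi Up lam0).
  by rewrite expr0 mul1r mulrA.
have hd := homogeneous_pdy i oU CFp coU h1.
have hl := homogeneous_pdy i oU CF coU hF.
(* F phi_i is the difference of the h(0) functions (F phi)_i and phi F_i *)
have e p : U p -> F p * pdy i phi p =
    pdy i (fun q => F q * phi q) p - phi p * pdy i F p.
  move=> Up; rewrite pdyM; last 2 first.
  - exact: smooth_differentiable CF Up.
  - exact: smooth_differentiable Cphi Up.
  by rewrite addrK.
move=> p lam Up lam0; rewrite expr0 mul1r e ?e //; last exact: coU.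
by rewrite (hd _ _ Up lam0) (hl _ _ Up lam0) (hphi Up lam0) expr0 !mul1r.
Qed.

(** The gradient of phi_{;2} has no component along l_i. As m is not assumed
    homogeneous, Euler's theorem is applied to F d_j phi = phi_{;2} m_j. *)
Lemma gradient_vder2_phi p i : U p -> F p * pdy i u p = vder2 F m u p * mm i p.
Proof.
move=> Up; apply: fiber_gradient => //.
have [j mj0] := m_neq0 Up.
have Cg : smooth_on U (fun q => F q * pdy j phi q).
  by apply: smoothM CF _ => //; exact: smooth_pdy.
have := euler oU Cg (homogeneous_gradient j) Up.
have du : differentiable u p := smooth_differentiable smooth_vder2_phi Up.
have dm : differentiable (mm j) p := smooth_differentiable (smooth_m j) Up.
rewrite mul0r !sum2E !(eq_pdy _ oU (fun q Uq => gradient_phi j Uq) Up) !pdyM //.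
move=> e; apply: (mulfI (F_neq0 Up)); apply: (mulIf mj0); rewrite mulr0 mul0r.
have := euler_m Up; rewrite sum2E => ym.
apply: (lin_comb (F p) e).
apply: (lin_comb (- (u p * p.2 0 0)) (pdy_m 0 j Up)).
apply: (lin_comb (- (u p * p.2 0 1)) (pdy_m 1 j Up)).
apply: (lin_comb (- (u p * (eps * I p * mm j p - pdy j F p))) ym).
ring.
Qed.

Lemma smooth_sigma : smooth_on U (sigma eps F m I phi).
Proof.
have c x := @smooth_cst R _ U x.
have C1 := smooth_vder2 smooth_vder2_phi.
have C2 := smoothM oU (smoothM oU (c eps) smooth_main_scalar) smooth_vder2_phi.
have C3 := smoothM oU (c 2) (smooth_sqr oU smooth_vder2_phi).
exact: smoothD oU (smoothD oU C1 C2) C3.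
Qed.

Lemma smooth_inv_rho : smooth_on U w.
Proof.
have C := smoothN oU (smooth_sqr oU smooth_vder2_phi).
exact: smoothD oU (smoothD oU smooth_sigma (smooth_cst _ _)) C.
Qed.

Lemma inv_rho_neq0 p : U p -> w p != 0.
Proof. by move=> Up; rewrite /= [_ + eps]addrC regular. Qed.

Lemma inv_rhoE p : U p ->
  w p = vder2 F m u p + eps * I p * u p + u p ^+ 2 + eps.
Proof.
move=> _; rewrite /sigma.
by move: (vder2 F m (vder2 F m phi) p) (vder2 F m phi p) => b a; ring.
Qed.

Lemma vder2_rho p : U p ->
  vder2 F m (rho eps F m I phi) p = - w p ^- 2 * vder2 F m w p.
Proof.
move=> Up; have dw : differentiable w p := smooth_differentiable smooth_inv_rho Up.
rewrite (vder2E (rho eps F m I phi) Up) (vder2E w Up).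
rewrite !(pdyV _ (inv_rho_neq0 Up) dw).
move: (w p) (pdy 0 w p) (pdy 1 w p) => v d0 d1; ring.
Qed.

(** The condition on the main scalar is the vanishing of the factor in cartan_bar. *)
Lemma riemannian_main_scalarP p : U p ->
  I p = eps / 2 * (vder2 F m (rho eps F m I phi) p / rho eps F m I phi p
                   - 4 * u p) <->
  riemannian_at (fun q => expR (phi q) * F q) p.
Proof.
move=> Up.
rewrite (riemannian_bar Cphi hphi smooth_vder2_phi smooth_inv_rho gradient_phi
  gradient_vder2_phi inv_rhoE Up) vder2_rho // /rho.
have /= := inv_rho_neq0 Up.
move: (vder2 F m w p) (u p) (sigma eps F m I phi p + eps - u p ^+ 2).
move=> w2 v1 v v0.
split=> [->|h].
  by apply: (lin_comb (- (w2 + 4 * v * v1)) epsE); field.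
apply: (mulfI (_ : 2 * v != 0)); first by rewrite mulf_neq0 ?pnatr_eq0.
apply: (mulfI eps_neq0).
apply: (lin_comb 1 h); apply: (lin_comb (w2 + 4 * v * v1) epsE).
by field.
Qed.

Lemma Cbar_contractionP p : U p ->
  (forall j k, \sum_(i < 2)
     cartan_up (fun q => expR (phi q) * F q) i j k p * dx i phi p = 0) <->
  riemannian_at (fun q => expR (phi q) * F q) p \/
  m_dx F m phi p - eps * u p * ell_dx F phi p = 0.
Proof.
exact: Cbar_contraction Cphi hphi smooth_vder2_phi smooth_inv_rho gradient_phi
  gradient_vder2_phi inv_rhoE inv_rho_neq0 _.
Qed.

End AnisotropicChange.
End BerwaldFrame.

(** * The conformal changes whose gradient annihilates the Cartan tensor *)

Theorem proposition3p4 (R : realType) (M : surface R)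
  (A : chart M -> set (tpair R)) (F : chart M -> tpair R -> R)
  (eps : R) (m : chart M -> tpair R -> 'rV[R]_2)
  (I phi : chart M -> tpair R -> R)
  (hA : conic_subbundle A)
  (hF : conic_pseudo_finsler A F)
  (hm : berwald_frame A F eps m)
  (hI : main_scalar A F m I)
  (hphi : proper_anisotropic_conformal A F eps m I phi)
  (D : chart M -> set (tpair R))
  (hD : forall a, D a `<=` A a) :
  let Fbar := conformal_change phi F in
  [/\ C_anisotropic_on D F phi <->
        (forall a p, D a p ->
           riemannian_at (F a) p \/ m_dx (F a) (m a) (phi a) p = 0),
      (Cbar_anisotropic_on D F phi <->
        (forall a p, D a p ->
           I a p = riemannian_main_scalar F eps m I phi a p \/
           m_dx (F a) (m a) (phi a) p
           - eps * vder2 (F a) (m a) (phi a) p * ell_dx (F a) (phi a) p = 0)) /\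
      (forall a p, D a p ->
         (I a p = riemannian_main_scalar F eps m I phi a p <->
          riemannian_at (Fbar a) p)) &
      (forall a p, D a p -> ~ riemannian_at (F a) p) ->
      (forall a p, D a p -> ~ riemannian_at (Fbar a) p) ->
      C_anisotropic_on D F phi ->
      (Cbar_anisotropic_on D F phi <->
        (forall a p, D a p -> ell_dx (F a) (phi a) p = 0))].
Proof.
move=> Fbar.
have [_ _ oA _ [coA _]] := hA; have [_ CF hF1 gU] := hF.
have [eps1 Cm gE] := hm; have [[_ Cphi hphi0 regular] proper] := hphi.
have eps2 : eps ^+ 2 = 1 by case: eps1 => ->; rewrite ?sqrrN expr1n.
have coA' a : conic (A a) := coA a.
have C_iff a p : A a p ->
    (forall j k, \sum_(i < 2) cartan_up (F a) i j k p * dx i (phi a) p = 0) <->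
    riemannian_at (F a) p \/ m_dx (F a) (m a) (phi a) p = 0.
  exact: (C_contraction (oA a) (CF a) (gU a) (gE a) (hI a)).
have Cbar_iff a p : A a p ->
    (forall j k, \sum_(i < 2) cartan_up (Fbar a) i j k p * dx i (phi a) p = 0) <->
    riemannian_at (Fbar a) p \/ m_dx (F a) (m a) (phi a) p
      - eps * vder2 (F a) (m a) (phi a) p * ell_dx (F a) (phi a) p = 0.
  exact: (Cbar_contractionP (oA a) (coA' a) (CF a) (hF1 a) (gU a) eps2 (Cm a)
    (gE a) (hI a) (Cphi a) (hphi0 a) (regular a)).
have riem_iff a p : A a p ->
    I a p = riemannian_main_scalar F eps m I phi a p <->
    riemannian_at (Fbar a) p.
  exact: (riemannian_main_scalarP (oA a) (coA' a) (CF a) (hF1 a) (gU a) eps2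
    (Cm a) (gE a) (hI a) (Cphi a) (hphi0 a) (regular a)).
split.
- by split=> h a p Dp; apply/(C_iff a p (hD a p Dp))/h.
- split=> [|a p Dp]; last exact/riem_iff/hD.
  split=> h a p Dp; have Ap := hD a p Dp.
    by have /(Cbar_iff a p Ap)[/(riem_iff a p Ap)|] := h a p Dp; [left|right].
  apply/(Cbar_iff a p Ap).
  by have [/(riem_iff a p Ap)|] := h a p Dp; [left|right].
move=> nF nFbar hC.
have m0 a p : D a p -> m_dx (F a) (m a) (phi a) p = 0.
  by move=> Dp; have /(C_iff a p (hD a p Dp))[/nF|] := hC a p Dp.
split=> h a p Dp; have Ap := hD a p Dp.
  have /(Cbar_iff a p Ap)[/nFbar|] := h a p Dp; first by move=> /(_ Dp).
  move=> /eqP; rewrite m0 // sub0r oppr_eq0 !mulf_eq0.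
  by rewrite (negPf (eps_neq0 eps2)) (negPf (proper a p Ap)) => /eqP.
by apply/(Cbar_iff a p Ap); right; rewrite m0 // h // mulr0 subrr.
Qed.
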